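(* Let $X$ be a pseudocubical object with pseudoconnections in an abelian category. Then the natural monomorphism of chain complexes $i: M(X)\to N(X)$ is a chain homotopy equivalence and, therefore, $i_*: H_n(M(X))\to H_n(N(X))$ is an isomorphism for all $n\ge 0$.
   Context: A precubical object $X$ in a category $\mathscr{A}$ is a family of objects $(X_n)_{n\ge 0}$ with face morphisms $\partial_i^0,\partial_i^1: X_n\to X_{n-1}$ ($1\le i\le n$) satisfying $\partial_i^\alpha\partial_j^\varepsilon=\partial_{j-1}^\varepsilon\partial_i^\alpha$ for $i<j$, $\alpha,\varepsilon\in\{0,1\}$. A pseudocubical object is a precubical object together with pseudodegeneracy morphisms $s_i: X_{n-1}\to X_n$ ($1\le i\le n$) satisfying, for $\alpha\in\{0,1\}$: $\partial_i^\alpha s_j=s_{j-1}\partial_i^\alpha$ if $i<j$; $\partial_i^\alpha s_j=\mathrm{id}$ if $i=j$; $\partial_i^\alpha s_j=s_j\partial_{i-1}^\alpha$ if $i>j$. (No relation between $s_is_j$ and $s_{j+1}s_i$ is required.) A pseudocubical object has pseudoconnections if there are given morphisms $\Gamma_i: X_n\to X_{n+1}$ ($1\le i\le n$) satisfying: $\partial_i^\alpha\Gamma_j=\Gamma_{j-1}\partial_i^\alpha$ if $i<j$, $\alpha\in\{0,1\}$; $\partial_i^0\Gamma_j=\mathrm{id}$ if $i=j,j+1$; $\partial_i^1\Gamma_j=s_j\partial_j^1$ if $i=j,j+1$; $\partial_i^\alpha\Gamma_j=\Gamma_j\partial_{i-1}^\alpha$ if $i>j+1$, $\alpha\in\{0,1\}$.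 For a precubical object $X$ in an abelian category, $N(X)$ is the nonnegative chain complex with $N_0(X)=X_0$, $N_n(X)=\bigcap_{i=1}^n\ker(\partial_i^1: X_n\to X_{n-1})$ for $n>0$, and differential $\partial=\sum_{i=1}^n(-1)^{i+1}\partial_i^0: N_n(X)\to N_{n-1}(X)$. Its subcomplex $M(X)$ (the Moore chain complex) has $M_0(X)=X_0$, $M_n(X)=\left(\bigcap_{i=1}^n\ker\partial_i^1\right)\cap\left(\bigcap_{i=1}^{n-1}\ker\partial_i^0\right)$ for $n>0$, with differential $(-1)^{n+1}\partial_n^0: M_n(X)\to M_{n-1}(X)$. The morphism $i: M(X)\to N(X)$ is the inclusion. *)

(* Defs.v *)
From HB Require Import structures.
From mathcomp Require Import all_boot all_algebra boolp.
From mathcomp Require Import zify.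

Set Implicit Arguments.
Unset Strict Implicit.
Unset Printing Implicit Defensive.

Import GRing.Theory.
Local Open Scope ring_scope.

Declare Scope cat_scope.
Delimit Scope cat_scope with cat.
Local Open Scope cat_scope.

Structure category := Category {
  obj :> Type;
  hom : obj -> obj -> Type;
  idm : forall A, hom A A;
  compm : forall A B C, hom B C -> hom A B -> hom A C;
  compmA : forall A B C D (h : hom C D) (g : hom B C) (f : hom A B),
    compm h (compm g f) = compm (compm h g) f;
  comp1m : forall A B (f : hom A B), compm (idm B) f = f;
  compm1 : forall A B (f : hom A B), compm f (idm A) = f }.

Arguments hom {_} _ _.
Arguments idm {_} _.
Arguments compm {_ _ _ _} _ _.

Notation "g ∘ f" := (compm g f) (at level 40, left associativity) : cat_scope.

Section CategoryTheory.
Variable C : category.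

Definition monomorphism (A B : C) (f : hom A B) : Prop :=
  forall T (u v : hom T A), f ∘ u = f ∘ v -> u = v.

Definition epimorphism (A B : C) (f : hom A B) : Prop :=
  forall T (u v : hom B T), u ∘ f = v ∘ f -> u = v.

Definition isomorphism (A B : C) (f : hom A B) : Prop :=
  exists g : hom B A, g ∘ f = idm A /\ f ∘ g = idm B.

Definition is_zero_object (Z : C) : Prop :=
  forall X : C, (exists! f : hom Z X, True) /\ (exists! f : hom X Z, True).

Definition factors (S X T : C) (m : hom S X) (t : hom T X) : Prop :=
  exists u : hom T S, m ∘ u = t.

(* [l] represents the intersection of the subobjects [k i] of [X], i.e. their
   greatest lower bound, tested on arbitrary generalized elements of [X]. *)
Definition is_intersection (I : Type) (X : C) (K : I -> C)
    (k : forall i, hom (K i) X) (L : C) (l : hom L X) : Prop :=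
  monomorphism l /\
  forall T (t : hom T X), factors l t <-> (forall i, factors (k i) t).

End CategoryTheory.

Structure preadditive := Preadditive {
  pre_cat :> category;
  hom_zero : forall A B : pre_cat, hom A B;
  hom_opp : forall A B : pre_cat, hom A B -> hom A B;
  hom_add : forall A B : pre_cat, hom A B -> hom A B -> hom A B;
  hom_addA : forall A B : pre_cat, associative (@hom_add A B);
  hom_addC : forall A B : pre_cat, commutative (@hom_add A B);
  hom_add0 : forall A B : pre_cat,
    left_id (@hom_zero A B) (@hom_add A B);
  hom_addN : forall A B : pre_cat,
    left_inverse (@hom_zero A B) (@hom_opp A B) (@hom_add A B);
  compm_addl : forall (A B D : pre_cat) (g h : hom B D) (f : hom A B),
    hom_add g h ∘ f = hom_add (g ∘ f) (h ∘ f);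
  compm_addr : forall (A B D : pre_cat) (g : hom B D) (f h : hom A B),
    g ∘ hom_add f h = hom_add (g ∘ f) (g ∘ h) }.

(* A [zmodType] is in particular a [choiceType]; the classical axioms provide
   that structure on arbitrary hom-sets. *)
HB.instance Definition _ (C : category) (A B : C) := gen_eqMixin (hom A B).
HB.instance Definition _ (C : category) (A B : C) := gen_choiceMixin (hom A B).
HB.instance Definition _ (C : preadditive) (A B : C) :=
  GRing.isZmodule.Build (hom A B)
    (@hom_addA C A B) (@hom_addC C A B) (@hom_add0 C A B) (@hom_addN C A B).

Section PreadditiveTheory.
Variable C : preadditive.

Lemma compmDl (A B D : C) (g h : hom B D) (f : hom A B) :
  (g + h) ∘ f = g ∘ f + h ∘ f.
Proof. exact: compm_addl. Qed.

Lemma compmDr (A B D : C) (g : hom B D) (f h : hom A B) :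
  g ∘ (f + h) = g ∘ f + g ∘ h.
Proof. exact: compm_addr. Qed.

Lemma comp0m (A B D : C) (f : hom A B) : (0 : hom B D) ∘ f = 0.
Proof. by apply: (addrI ((0 : hom B D) ∘ f)); rewrite -compmDl !addr0. Qed.

Lemma compm0 (A B D : C) (g : hom B D) : g ∘ (0 : hom A B) = 0.
Proof. by apply: (addrI (g ∘ (0 : hom A B))); rewrite -compmDr !addr0. Qed.

Lemma compNm (A B D : C) (g : hom B D) (f : hom A B) : (- g) ∘ f = - (g ∘ f).
Proof. by apply: (addrI (g ∘ f)); rewrite -compmDl !subrr comp0m. Qed.

Lemma compmN (A B D : C) (g : hom B D) (f : hom A B) : g ∘ (- f) = - (g ∘ f).
Proof. by apply: (addrI (g ∘ f)); rewrite -compmDr !subrr compm0. Qed.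

Lemma compm_suml (A B D : C) (I : Type) (r : seq I) (P : pred I)
    (g : I -> hom B D) (f : hom A B) :
  (\sum_(i <- r | P i) g i) ∘ f = \sum_(i <- r | P i) (g i ∘ f).
Proof.
apply: (big_morph (fun g : hom B D => g ∘ f)) => [x y|].
  exact: compmDl.
exact: comp0m.
Qed.

Lemma compm_sumr (A B D : C) (I : Type) (r : seq I) (P : pred I)
    (g : hom B D) (f : I -> hom A B) :
  g ∘ (\sum_(i <- r | P i) f i) = \sum_(i <- r | P i) (g ∘ f i).
Proof.
apply: (big_morph (fun f : hom A B => g ∘ f)) => [x y|].
  exact: compmDr.
exact: compm0.
Qed.

Lemma compm_mulzl (A B D : C) (g : hom B D) (f : hom A B) (z : int) :
  (g *~ z) ∘ f = (g ∘ f) *~ z.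
Proof.
have nat_case (n : nat) (h : hom B D) : (h *+ n) ∘ f = (h ∘ f) *+ n.
  by elim: n => [|n IH]; rewrite ?mulr0n ?comp0m // !mulrS compmDl IH.
by case: z => n; rewrite ?NegzE ?mulrNz ?compNm -!pmulrn nat_case.
Qed.

Lemma compm_mulzr (A B D : C) (g : hom B D) (f : hom A B) (z : int) :
  g ∘ (f *~ z) = (g ∘ f) *~ z.
Proof.
have nat_case (n : nat) (h : hom A B) : g ∘ (h *+ n) = (g ∘ h) *+ n.
  by elim: n => [|n IH]; rewrite ?mulr0n ?compm0 // !mulrS compmDr IH.
by case: z => n; rewrite ?NegzE ?mulrNz ?compmN -!pmulrn nat_case.
Qed.

Definition is_biproduct (A B P : C) (i1 : hom A P) (i2 : hom B P)
    (p1 : hom P A) (p2 : hom P B) : Prop :=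
  [/\ p1 ∘ i1 = idm A, p2 ∘ i2 = idm B, p1 ∘ i2 = 0, p2 ∘ i1 = 0
    & i1 ∘ p1 + i2 ∘ p2 = idm P].

Definition is_kernel (A B K : C) (f : hom A B) (k : hom K A) : Prop :=
  f ∘ k = 0 /\
  forall T (t : hom T A), f ∘ t = 0 -> exists! u : hom T K, k ∘ u = t.

Definition is_cokernel (A B Q : C) (f : hom A B) (q : hom B Q) : Prop :=
  q ∘ f = 0 /\
  forall T (t : hom B T), t ∘ f = 0 -> exists! u : hom Q T, u ∘ q = t.

End PreadditiveTheory.

Structure abelian := Abelian {
  ab_pre :> preadditive;
  has_zero_object : exists Z : ab_pre, is_zero_object Z;
  has_biproducts : forall A B : ab_pre,
    exists (P : ab_pre) (i1 : hom A P) (i2 : hom B P)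
           (p1 : hom P A) (p2 : hom P B), is_biproduct i1 i2 p1 p2;
  has_kernels : forall (A B : ab_pre) (f : hom A B),
    exists (K : ab_pre) (k : hom K A), is_kernel f k;
  has_cokernels : forall (A B : ab_pre) (f : hom A B),
    exists (Q : ab_pre) (q : hom B Q), is_cokernel f q;
  mono_normal : forall (A B : ab_pre) (m : hom A B), monomorphism m ->
    exists (D : ab_pre) (f : hom B D), is_kernel f m;
  epi_normal : forall (A B : ab_pre) (e : hom A B), epimorphism e ->
    exists (D : ab_pre) (f : hom D A), is_cokernel f e }.

Section AbelianTheory.
Variable C : abelian.

Definition zero_obj : C := sval (cid (has_zero_object C)).

Lemma zero_objP : is_zero_object zero_obj.
Proof. exact: svalP (cid (has_zero_object C)). Qed.

Section KernelCokernel.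
Variables (A B : C) (f : hom A B).

Definition kernel : C := sval (cid (has_kernels f)).
Definition ker : hom kernel A := sval (cid (svalP (cid (has_kernels f)))).
Definition cokernel : C := sval (cid (has_cokernels f)).
Definition coker : hom B cokernel := sval (cid (svalP (cid (has_cokernels f)))).

Lemma kerP : is_kernel f ker.
Proof. exact: svalP (cid (svalP (cid (has_kernels f)))). Qed.

Lemma cokerP : is_cokernel f coker.
Proof. exact: svalP (cid (svalP (cid (has_cokernels f)))). Qed.

Lemma ker_comp : f ∘ ker = 0. Proof. by case: kerP. Qed.

Lemma coker_comp : coker ∘ f = 0. Proof. by case: cokerP. Qed.

Lemma ker_mono : monomorphism ker.
Proof.
move=> T u v uv; have [_ /(_ T (ker ∘ u))] := kerP.
case=> [|w [_ wU]]; first by rewrite compmA ker_comp comp0m.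
by rewrite -(wU u) // -(wU v).
Qed.

Lemma coker_epi : epimorphism coker.
Proof.
move=> T u v uv; have [_ /(_ T (u ∘ coker))] := cokerP.
case=> [|w [_ wU]]; first by rewrite -compmA coker_comp compm0.
by rewrite -(wU u) // -(wU v).
Qed.

Lemma ker_factors (T : C) (t : hom T A) : factors ker t <-> f ∘ t = 0.
Proof.
split=> [[u <-]|ft0]; first by rewrite compmA ker_comp comp0m.
by have [_ /(_ T t ft0) [u [uP _]]] := kerP; exists u.
Qed.

Lemma coker_factors (T : C) (t : hom B T) :
  t ∘ f = 0 -> exists u : hom cokernel T, u ∘ coker = t.
Proof. by move=> tf0; have [_ /(_ T t tf0) [u [uP _]]] := cokerP; exists u. Qed.

End KernelCokernel.

Section KernelIntersection.
Variables (I : finType) (X Y : C) (f : I -> hom X Y).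

Lemma kernels_intersection_ex : exists (L : C) (l : hom L X),
  is_intersection (fun i => ker (f i)) l.
Proof.
suff /(_ (enum I)) [L [l [lM lP]]] : forall s : seq I, exists (L : C)
    (l : hom L X), monomorphism l /\ forall T (t : hom T X),
    factors l t <-> (forall i, i \in s -> factors (ker (f i)) t).
  exists L, l; split=> // T t; rewrite lP; split=> H i; last by move=> _.
  by apply: H; rewrite mem_enum.
elim=> [|i s [L [l [lM lP]]]].
  exists X, (idm X); split=> [T u v|T t]; first by rewrite !comp1m.
  by split=> // _; exists t; rewrite comp1m.
exists (kernel (f i ∘ l)), (l ∘ ker (f i ∘ l)); split=> [T u v|T t].
  by rewrite -!compmA => /lM; apply: ker_mono.
split=> [[u ut] j|H].
  rewrite inE => /predU1P [->|js].
    by apply/ker_factors; rewrite -ut !compmA ker_comp comp0m.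
  by apply: (proj1 (lP T t) _ j js); exists (ker (f i ∘ l) ∘ u); rewrite compmA.
have [|u ut] := proj2 (lP T t); first by move=> j js; apply: H; rewrite inE js orbT.
have /ker_factors fit := H i (mem_head _ _).
have /(@ker_factors _ _ (f i ∘ l)) [w wu] : f i ∘ l ∘ u = 0.
  by rewrite -compmA ut.
by exists w; rewrite -compmA wu.
Qed.

Definition ker_meet_obj : C := sval (cid kernels_intersection_ex).
Definition ker_meet : hom ker_meet_obj X :=
  sval (cid (svalP (cid kernels_intersection_ex))).

Lemma ker_meetP : is_intersection (fun i => ker (f i)) ker_meet.
Proof. exact: svalP (cid (svalP (cid kernels_intersection_ex))). Qed.

Lemma ker_meet_comp i : f i ∘ ker_meet = 0.
Proof.
apply/ker_factors; apply: (proj1 (proj2 ker_meetP _ _)).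
by exists (idm _); rewrite compm1.
Qed.

Lemma ker_meet_factors (T : C) (t : hom T X) :
  (forall i, f i ∘ t = 0) -> factors ker_meet t.
Proof. by move=> ft; apply/(proj2 ker_meetP) => i; apply/ker_factors. Qed.

End KernelIntersection.
End AbelianTheory.

Structure chain_complex (C : preadditive) := ChainComplex {
  cc_obj :> nat -> C;
  cc_d : forall n, hom (cc_obj n.+1) (cc_obj n);
  cc_dd : forall n, cc_d n ∘ cc_d n.+1 = 0 }.

Structure chain_map (C : preadditive) (D E : chain_complex C) := ChainMap {
  cm_map :> forall n, hom (D n) (E n);
  cm_comm : forall n, cc_d E n ∘ cm_map n.+1 = cm_map n ∘ cc_d D n }.

Section ChainComplexes.
Variable C : preadditive.

Definition chain_id (D : chain_complex C) : chain_map D D.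
Proof.
by refine (@ChainMap C D D (fun n => idm (D n)) _) => n; rewrite compm1 comp1m.
Defined.

Definition chain_comp (D E F : chain_complex C)
  (g : chain_map E F) (f : chain_map D E) : chain_map D F.
Proof.
refine (@ChainMap C D F (fun n => g n ∘ f n) _) => n.
by rewrite compmA cm_comm -compmA cm_comm compmA.
Defined.

Definition chain_homotopic (D E : chain_complex C) (f g : chain_map D E) : Prop :=
  exists h : forall n, hom (D n) (E n.+1),
    f 0%N - g 0%N = cc_d E 0 ∘ h 0%N /\
    forall n, f n.+1 - g n.+1 = cc_d E n.+1 ∘ h n.+1 + h n ∘ cc_d D n.

Definition chain_homotopy_equivalence (D E : chain_complex C)
    (f : chain_map D E) : Prop :=
  exists g : chain_map E D,
    chain_homotopic (chain_comp g f) (chain_id D) /\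
    chain_homotopic (chain_comp f g) (chain_id E).

End ChainComplexes.

Section Homology.
Variable C : abelian.

Section HomologyObject.
Variable D : chain_complex C.

Definition cc_prev n : C := if n is m.+1 then D m else zero_obj C.

Definition cc_dout n : hom (D n) (cc_prev n) :=
  match n return hom (D n) (cc_prev n) with
  | 0%N => 0
  | m.+1 => cc_d D m
  end.

Definition cycles n : C := kernel (cc_dout n).

Lemma to_cycles_ex n : factors (ker (cc_dout n)) (cc_d D n).
Proof. by apply/ker_factors; case: n => [|n]; rewrite /= ?comp0m ?cc_dd. Qed.

Definition to_cycles n : hom (D n.+1) (cycles n) := sval (cid (to_cycles_ex n)).

Lemma to_cyclesE n : ker (cc_dout n) ∘ to_cycles n = cc_d D n.
Proof. exact: svalP (cid (to_cycles_ex n)). Qed.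

(* The cokernel of [D n.+1 -> cycles n] is the quotient of the cycles by the
   image of the differential. *)
Definition homology n : C := cokernel (to_cycles n).

End HomologyObject.

Section HomologyMap.
Variables (D E : chain_complex C) (f : chain_map D E).

Lemma cycles_map_ex n :
  factors (ker (cc_dout E n)) (f n ∘ ker (cc_dout D n)).
Proof.
apply/ker_factors; rewrite compmA; case: n => [|n] /=; first by rewrite !comp0m.
by rewrite cm_comm -compmA (ker_comp (cc_d D n)) compm0.
Qed.

Definition cycles_map n : hom (cycles D n) (cycles E n) :=
  sval (cid (cycles_map_ex n)).

Lemma cycles_mapE n :
  ker (cc_dout E n) ∘ cycles_map n = f n ∘ ker (cc_dout D n).
Proof. exact: svalP (cid (cycles_map_ex n)). Qed.

Lemma homology_map_ex n : exists u : hom (homology D n) (homology E n),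
  u ∘ coker (to_cycles D n) = coker (to_cycles E n) ∘ cycles_map n.
Proof.
apply: coker_factors.
have -> : coker (to_cycles E n) ∘ cycles_map n ∘ to_cycles D n =
          coker (to_cycles E n) ∘ to_cycles E n ∘ f n.+1.
  rewrite -!compmA; congr (_ ∘ _); apply: (@ker_mono _ _ _ (cc_dout E n)).
  by rewrite !compmA cycles_mapE to_cyclesE cm_comm -compmA to_cyclesE.
by rewrite coker_comp comp0m.
Qed.

Definition homology_map n : hom (homology D n) (homology E n) :=
  sval (cid (homology_map_ex n)).

Lemma homology_mapE n :
  homology_map n ∘ coker (to_cycles D n) = coker (to_cycles E n) ∘ cycles_map n.
Proof. exact: svalP (cid (homology_map_ex n)). Qed.

End HomologyMap.
End Homology.

(* Structure maps are indexed by [nat], with the numbering 1, 2, ...; only the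
   values at indices in the ranges stated below are meaningful, and the values
   at other indices are arbitrary and never used.  The superscripts 0 and 1 of
   the faces are the booleans [false] and [true]. *)
Structure precubical (C : category) := Precubical {
  pc_obj :> nat -> C;
  (* [face n a i : X_(n+1) -> X_n], for 1 <= i <= n+1 *)
  face : forall n, bool -> nat -> hom (pc_obj n.+1) (pc_obj n);
  face_face : forall n (a e : bool) (i j : nat),
    (1 <= i)%N -> (i < j)%N -> (j <= n.+2)%N ->
    face n a i ∘ face n.+1 e j = face n e j.-1 ∘ face n.+1 a i }.

Arguments face {_} _ _ _ _.

Structure pseudocubical (C : category) := Pseudocubical {
  ps_pre :> precubical C;
  (* [psdeg n i : X_n -> X_(n+1)], for 1 <= i <= n+1 *)
  psdeg : forall n, nat -> hom (ps_pre n) (ps_pre n.+1);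
  face_psdeg_lt : forall n (a : bool) (i j : nat),
    (1 <= i)%N -> (i < j)%N -> (j <= n.+2)%N ->
    face ps_pre n.+1 a i ∘ psdeg n.+1 j = psdeg n j.-1 ∘ face ps_pre n a i;
  face_psdeg_eq : forall n (a : bool) (i : nat),
    (1 <= i)%N -> (i <= n.+1)%N ->
    face ps_pre n a i ∘ psdeg n i = idm (ps_pre n);
  face_psdeg_gt : forall n (a : bool) (i j : nat),
    (1 <= j)%N -> (j < i)%N -> (i <= n.+2)%N ->
    face ps_pre n.+1 a i ∘ psdeg n.+1 j = psdeg n j ∘ face ps_pre n a i.-1 }.

Arguments psdeg {_} _ _ _.

Structure pseudoconnections (C : category) (X : pseudocubical C) :=
  Pseudoconnections {
  (* [psconn n i : X_(n+1) -> X_(n+2)], for 1 <= i <= n+1 *)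
  psconn : forall n, nat -> hom (X n.+1) (X n.+2);
  face_psconn_lt : forall n (a : bool) (i j : nat),
    (1 <= i)%N -> (i < j)%N -> (j <= n.+2)%N ->
    face X n.+2 a i ∘ psconn n.+1 j = psconn n j.-1 ∘ face X n.+1 a i;
  face0_psconn : forall n (i j : nat),
    (1 <= j)%N -> (j <= n.+1)%N -> i = j \/ i = j.+1 ->
    face X n.+1 false i ∘ psconn n j = idm (X n.+1);
  face1_psconn : forall n (i j : nat),
    (1 <= j)%N -> (j <= n.+1)%N -> i = j \/ i = j.+1 ->
    face X n.+1 true i ∘ psconn n j = psdeg X n j ∘ face X n true j;
  face_psconn_gt : forall n (a : bool) (i j : nat),
    (1 <= j)%N -> (j.+1 < i)%N -> (i <= n.+3)%N ->
    face X n.+2 a i ∘ psconn n.+1 j = psconn n j ∘ face X n.+1 a i.-1 }.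

Section NormalizedComplexes.
Variables (C : abelian) (X : precubical C).

Definition norm_faces n (i : 'I_n.+1) : hom (X n.+1) (X n) := face X n true i.+1.

Definition norm_obj n : C :=
  if n is m.+1 then ker_meet_obj (@norm_faces m) else X 0.

Definition norm_incl n : hom (norm_obj n) (X n) :=
  match n return hom (norm_obj n) (X n) with
  | 0%N => idm (X 0)
  | m.+1 => ker_meet (@norm_faces m)
  end.

Definition alt_face n : hom (X n.+1) (X n) :=
  \sum_(1 <= i < n.+2) face X n false i *~ (-1) ^+ i.+1.

Definition moore_faces n (i : 'I_n.+1 + 'I_n) : hom (X n.+1) (X n) :=
  match i with
  | inl j => face X n true j.+1
  | inr j => face X n false j.+1
  end.

Definition moore_obj n : C :=
  if n is m.+1 then ker_meet_obj (@moore_faces m) else X 0.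

Definition moore_incl n : hom (moore_obj n) (X n) :=
  match n return hom (moore_obj n) (X n) with
  | 0%N => idm (X 0)
  | m.+1 => ker_meet (@moore_faces m)
  end.

Definition last_face n : hom (X n.+1) (X n) :=
  face X n false n.+1 *~ (-1) ^+ n.+2.

Lemma norm_incl_mono n : monomorphism (norm_incl n).
Proof.
case: n => [|n] /=; first by move=> T u v; rewrite !comp1m.
exact: (proj1 (ker_meetP _)).
Qed.

Lemma moore_incl_mono n : monomorphism (moore_incl n).
Proof.
case: n => [|n] /=; first by move=> T u v; rewrite !comp1m.
exact: (proj1 (ker_meetP _)).
Qed.

Lemma norm_incl_face n i : (1 <= i)%N -> (i <= n.+1)%N ->
  face X n true i ∘ norm_incl n.+1 = 0.
Proof.
by case: i => // i _ lt_in; exact: (ker_meet_comp (@norm_faces n) (Ordinal lt_in)).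
Qed.

Lemma moore_incl_face1 n i : (1 <= i)%N -> (i <= n.+1)%N ->
  face X n true i ∘ moore_incl n.+1 = 0.
Proof.
case: i => // i _ lt_in.
exact: (ker_meet_comp (@moore_faces n) (inl (Ordinal lt_in))).
Qed.

Lemma moore_incl_face0 n i : (1 <= i)%N -> (i <= n)%N ->
  face X n false i ∘ moore_incl n.+1 = 0.
Proof.
case: i => // i _ lt_in.
exact: (ker_meet_comp (@moore_faces n) (inr (Ordinal lt_in))).
Qed.

Lemma norm_incl_factors n (T : C) (t : hom T (X n.+1)) :
  (forall i, (1 <= i)%N -> (i <= n.+1)%N -> face X n true i ∘ t = 0) ->
  factors (norm_incl n.+1) t.
Proof. by move=> H; apply: ker_meet_factors => i; apply: H. Qed.

Lemma moore_incl_factors n (T : C) (t : hom T (X n.+1)) :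
  (forall i, (1 <= i)%N -> (i <= n.+1)%N -> face X n true i ∘ t = 0) ->
  (forall i, (1 <= i)%N -> (i <= n)%N -> face X n false i ∘ t = 0) ->
  factors (moore_incl n.+1) t.
Proof.
by move=> H1 H0; apply: ker_meet_factors => -[] i; [apply: H1 | apply: H0].
Qed.

Lemma alt_face_alt_face n : alt_face n ∘ alt_face n.+1 = 0.
Proof.
rewrite /alt_face !big_add1 /= !big_mkord compm_suml.
pose F (i j : nat) := (face X n false i.+1 ∘ face X n.+1 false j.+1) *~ (-1) ^+ (i + j).
rewrite (eq_bigr (fun i : 'I_n.+1 => \sum_(j < n.+2) F i j)); last first.
  move=> i _; rewrite compm_sumr; apply: eq_bigr => j _.
  rewrite compm_mulzr compm_mulzl -mulrzA /F; congr (_ *~ _).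
  by rewrite !exprS !mulN1r !opprK exprD.
rewrite pair_big /= (bigID (fun p : 'I_n.+1 * 'I_n.+2 => (p.1 < p.2)%N)) /=.
rewrite (reindex_onto (fun p : 'I_n.+1 * 'I_n.+2 => (inord p.2, inord p.1.+1))
                      (fun p : 'I_n.+1 * 'I_n.+2 => (inord p.2.-1, inord p.1))) /=;
  last first.
  case=> i j /= lt_ij; congr (_, _); apply: val_inj => /=.
    by rewrite inordK inordK //; have := ltn_ord i; have := ltn_ord j; lia.
  by rewrite inordK inordK //; have := ltn_ord i; have := ltn_ord j; lia.
have cond (i : 'I_n.+1) (j : 'I_n.+2) :
  ((inord j : 'I_n.+1) < (inord i.+1 : 'I_n.+2))%N &&
    ((inord (inord i.+1 : 'I_n.+2).-1, inord (inord j : 'I_n.+1)) == (i, j))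
  = ~~ (i < j)%N.
  rewrite -leqNgt (@inordK n.+1 i.+1 (ltn_ord i)) /=.
  have lt_jn := ltn_ord (inord j : 'I_n.+1).
  apply/andP/idP => [[lt_ji /eqP /(congr1 (fun p => val p.2)) /=]|le_ji].
    by rewrite (inordK (leqW lt_jn)) => e; move: lt_ji; rewrite e.
  have lt_j : (j < n.+1)%N by have := ltn_ord i; lia.
  by rewrite !inordK //; split; rewrite // !inord_val.
rewrite (eq_big (fun p : 'I_n.+1 * 'I_n.+2 => ~~ (p.1 < p.2)%N)
           (fun p => - F p.1 p.2)); first by rewrite sumrN addNr.
  by case=> i j /=; rewrite cond.
case=> i j /=; rewrite cond -leqNgt => le_ji.
have lt_j : (j < n.+1)%N by have := ltn_ord i; lia.
rewrite (inordK lt_j) (@inordK n.+1 i.+1 (ltn_ord i)) /F.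
rewrite (@face_face _ X n false false j.+1 i.+2 isT le_ji (ltn_ord i)) /=.
rewrite -mulrNz; congr (_ *~ _).
by rewrite addnS exprS mulN1r addnC.
Qed.

Lemma norm_d_ex n : factors (norm_incl n) (alt_face n ∘ norm_incl n.+1).
Proof.
case: n => [|n]; first by exists (alt_face 0 ∘ norm_incl 1); rewrite comp1m.
apply: norm_incl_factors => i i_gt0 le_in.
rewrite /alt_face compm_suml compm_sumr big_nat big1 // => j /andP [j_gt0 lt_jn].
rewrite compm_mulzl compm_mulzr compmA.
suff -> : face X n true i ∘ face X n.+1 false j ∘ norm_incl n.+2 = 0.
  by rewrite mul0rz.
have [lt_ij|le_ji] := ltnP i j.
  by rewrite face_face // -compmA norm_incl_face ?compm0 //; lia.
by rewrite -(@face_face _ X n false true j i.+1) // -compmA norm_incl_face ?compm0.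
Qed.

Definition norm_d n : hom (norm_obj n.+1) (norm_obj n) :=
  sval (cid (norm_d_ex n)).

Lemma norm_dE n : norm_incl n ∘ norm_d n = alt_face n ∘ norm_incl n.+1.
Proof. exact: svalP (cid (norm_d_ex n)). Qed.

Lemma norm_dd n : norm_d n ∘ norm_d n.+1 = 0.
Proof.
apply: (@norm_incl_mono n).
rewrite compmA norm_dE -compmA norm_dE compmA alt_face_alt_face.
by rewrite comp0m compm0.
Qed.

Lemma moore_d_ex n : factors (moore_incl n) (last_face n ∘ moore_incl n.+1).
Proof.
case: n => [|n]; first by exists (last_face 0 ∘ moore_incl 1); rewrite comp1m.
apply: moore_incl_factors => i i_gt0 le_in;
  rewrite compmA compm_mulzr compm_mulzl face_face //= -?compmA; try lia.
  by rewrite moore_incl_face1 ?compm0 ?mul0rz //; lia.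
by rewrite moore_incl_face0 ?compm0 ?mul0rz //; lia.
Qed.

Definition moore_d n : hom (moore_obj n.+1) (moore_obj n) :=
  sval (cid (moore_d_ex n)).

Lemma moore_dE n : moore_incl n ∘ moore_d n = last_face n ∘ moore_incl n.+1.
Proof. exact: svalP (cid (moore_d_ex n)). Qed.

Lemma moore_dd n : moore_d n ∘ moore_d n.+1 = 0.
Proof.
apply: (@moore_incl_mono n).
rewrite compm0 compmA moore_dE -compmA moore_dE compmA.
rewrite /last_face compm_mulzr !compm_mulzl face_face //=.
by rewrite -compmA moore_incl_face0 // compm0 !mul0rz.
Qed.

Definition norm_complex : chain_complex C := ChainComplex norm_dd.

Definition moore_complex : chain_complex C := ChainComplex moore_dd.

Lemma moore_to_norm_ex n : factors (norm_incl n) (moore_incl n).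
Proof.
case: n => [|n]; first by exists (idm _); rewrite compm1.
by apply: norm_incl_factors; exact: moore_incl_face1.
Qed.

Definition moore_to_norm_map n : hom (moore_obj n) (norm_obj n) :=
  sval (cid (moore_to_norm_ex n)).

Lemma moore_to_normE n : norm_incl n ∘ moore_to_norm_map n = moore_incl n.
Proof. exact: svalP (cid (moore_to_norm_ex n)). Qed.

Lemma moore_to_norm_comm n :
  norm_d n ∘ moore_to_norm_map n.+1 =
  moore_to_norm_map n ∘ moore_d n.
Proof.
apply: (@norm_incl_mono n).
rewrite compmA norm_dE -compmA moore_to_normE compmA moore_to_normE moore_dE.
rewrite /alt_face big_nat_recr //= compmDl compm_suml big_nat big1 ?add0r //.
move=> i /andP [i_gt0 lt_in].
by rewrite compm_mulzl moore_incl_face0 ?mul0rz.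
Qed.

Definition moore_to_norm : chain_map moore_complex norm_complex :=
  @ChainMap C moore_complex norm_complex moore_to_norm_map moore_to_norm_comm.

Lemma moore_to_norm_mono n : monomorphism (moore_to_norm n).
Proof.
move=> T u v uv; apply: (@moore_incl_mono n).
by rewrite -moore_to_normE -!compmA; congr (_ ∘ _).
Qed.

End NormalizedComplexes.

(* Main.v *)
Require Import Defs.
From mathcomp Require Import all_boot all_algebra boolp.
From mathcomp Require Import zify.

(** On [N(X)] the faces [∂^1] vanish, so the faces [∂^0] and the pseudoconnections
    restrict to [N(X)] and satisfy there the simplicial face-degeneracy
    identities (with degrees shifted by one).  As in the Dold-Kan normalization
    theorem, the chain endomorphism [f_k = 1 - (∂T_k + T_k∂)] with
    [T_k = (-1)^k Γ_{k+1}] equals [1 - Γ_{k+1} ∂_{k+1}^0] on the elements killed by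
    [∂_1^0, ..., ∂_k^0], hence sends them to elements killed by [∂_{k+1}^0] as
    well, and it fixes those already killed.  In each degree only finitely many
    [f_k] act nontrivially, so their infinite composite is a retraction of
    [N(X)] onto [M(X)] that is homotopic to the identity.  No relation between
    two degeneracies enters. *)

Set Implicit Arguments.
Unset Strict Implicit.
Unset Printing Implicit Defensive.

Import GRing.Theory.
(* [all_algebra] shadows [hom]. *)
Import Defs.
Local Open Scope ring_scope.
Local Open Scope cat_scope.

Lemma compmBl (C : preadditive) (A B D : C) (g h : hom B D) (f : hom A B) :
  (g - h) ∘ f = g ∘ f - h ∘ f.
Proof. by rewrite compmDl compNm. Qed.

Lemma compmBr (C : preadditive) (A B D : C) (g : hom B D) (f h : hom A B) :
  g ∘ (f - h) = g ∘ f - g ∘ h.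
Proof. by rewrite compmDr compmN. Qed.

(** * Homotopy invariance of homology *)

Section HomologyInvariance.
Variable C : abelian.

Lemma homology_map_unique (D E : chain_complex C) (f : chain_map D E) n
    (u : hom (homology D n) (homology E n)) :
  u ∘ coker (to_cycles D n) = coker (to_cycles E n) ∘ cycles_map f n ->
  u = homology_map f n.
Proof. by move=> uE; apply: (@coker_epi _ _ _ (to_cycles D n)); rewrite homology_mapE. Qed.

Lemma homology_map_id (D : chain_complex C) n :
  homology_map (chain_id D) n = idm (homology D n).
Proof.
apply/esym/homology_map_unique; rewrite comp1m -[LHS]compm1; congr (_ ∘ _).
by apply: (@ker_mono _ _ _ (cc_dout D n)); rewrite cycles_mapE compm1 comp1m.
Qed.

Lemma homology_map_comp (D E F : chain_complex C) (g : chain_map E F)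
    (f : chain_map D E) n :
  homology_map (chain_comp g f) n = homology_map g n ∘ homology_map f n.
Proof.
apply/esym/homology_map_unique; rewrite -compmA homology_mapE compmA homology_mapE.
rewrite -compmA; congr (_ ∘ _); apply: (@ker_mono _ _ _ (cc_dout F n)).
by rewrite compmA !cycles_mapE -compmA cycles_mapE compmA.
Qed.

(** On cycles the term [h d] vanishes, so [f - g] becomes [d h]; it factors through [to_cycles] and
    dies in the cokernel. *)
Lemma homology_map_homotopic (D E : chain_complex C) (f g : chain_map D E) n :
  chain_homotopic f g -> homology_map f n = homology_map g n.
Proof.
case=> h [h0 hS]; apply: homology_map_unique; rewrite homology_mapE.
apply/eqP; rewrite -subr_eq0 -compmBr.
suff -> : cycles_map f n - cycles_map g n =
          to_cycles E n ∘ (h n ∘ ker (cc_dout D n)).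
  by rewrite (compmA (coker _)) coker_comp comp0m.
apply: (@ker_mono _ _ _ (cc_dout E n)).
rewrite compmBr !cycles_mapE -compmBl !compmA to_cyclesE.
case: n => [|n]; first by rewrite h0.
by rewrite hS compmDl -[h n ∘ _ ∘ _]compmA (ker_comp (cc_d D n)) compm0 addr0.
Qed.

Lemma homotopy_equivalence_homology (D E : chain_complex C) (f : chain_map D E) n :
  chain_homotopy_equivalence f -> isomorphism (homology_map f n).
Proof.
case=> g [gf fg]; exists (homology_map g n).
by rewrite -!homology_map_comp (homology_map_homotopic n gf)
  (homology_map_homotopic n fg) !homology_map_id.
Qed.

End HomologyInvariance.

(** * Null-homotopic chain endomorphisms *)

Section HomotopyBoundary.
Variables (C : preadditive) (Y : chain_complex C).

Definition hboundary (h : forall n, hom (Y n) (Y n.+1)) n : hom (Y n) (Y n) :=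
  cc_d Y n ∘ h n +
  match n return hom (Y n) (Y n) with 0 => 0 | m.+1 => h m ∘ cc_d Y m end.

Lemma hboundary_comm h n :
  cc_d Y n ∘ hboundary h n.+1 = hboundary h n ∘ cc_d Y n.
Proof.
rewrite /hboundary compmDr compmDl compmA cc_dd comp0m add0r compmA.
case: n => [|n]; first by rewrite comp0m addr0.
by rewrite -[h n ∘ _ ∘ _]compmA cc_dd compm0 addr0.
Qed.

End HomotopyBoundary.

(** * Abstract normalization, killing one face at a time *)

(* A complex with the faces and degeneracies of a simplicial object shifted by
   one degree; the faces [Y 1 -> Y 0] play the role of an augmentation. *)
Section Normalization.
Variables (C : preadditive) (Y : chain_complex C).
Variable d : forall n, nat -> hom (Y n.+1) (Y n).
Variable s : forall n, nat -> hom (Y n.+1) (Y n.+2).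
Hypothesis dE : forall n, cc_d Y n = \sum_(0 <= i < n.+1) d n i *~ (-1) ^+ i.
Hypothesis d_d : forall n i j, (i < j)%N -> (j <= n.+1)%N ->
  d n i ∘ d n.+1 j = d n j.-1 ∘ d n.+1 i.
Hypothesis d_s_lt : forall n i j, (i < j)%N -> (j <= n.+1)%N ->
  d n.+2 i ∘ s n.+1 j = s n j.-1 ∘ d n.+1 i.
Hypothesis d_s_eq : forall n i j, (j <= n)%N -> i = j \/ i = j.+1 ->
  d n.+1 i ∘ s n j = idm (Y n.+1).
Hypothesis d_s_gt : forall n i j, (j.+1 < i)%N -> (i <= n.+2)%N ->
  d n.+2 i ∘ s n.+1 j = s n j ∘ d n.+1 i.-1.

(** Here [t] is a generalized element. The bound [i < m] exempts the last face, which survives as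
    the Moore differential; being killed for every [k] is thus the abstract Moore condition. *)
Definition killed k n (A : C) : hom A (Y n) -> Prop :=
  match n return hom A (Y n) -> Prop with
  | 0 => fun _ => True
  | m.+1 => fun t => forall i, (i < k)%N -> (i < m)%N -> d m i ∘ t = 0
  end.

Definition deg_htpy k n : hom (Y n) (Y n.+1) :=
  match n return hom (Y n) (Y n.+1) with
  | 0 => 0
  | m.+1 => if (k <= m)%N then s m k *~ (-1) ^+ k else 0
  end.

Definition norm_step k n : hom (Y n) (Y n) :=
  idm (Y n) - hboundary (deg_htpy k) n.

Lemma deg_htpy_0 k n : (n <= k)%N -> deg_htpy k n = 0.
Proof. by case: n => //= n; rewrite ltnNge => /negbTE ->. Qed.

Lemma norm_step_comm k n : cc_d Y n ∘ norm_step k n.+1 = norm_step k n ∘ cc_d Y n.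
Proof. by rewrite /norm_step compmBr compmBl hboundary_comm compm1 comp1m. Qed.

Lemma sum_nat_from k n (A B : C) (F : nat -> hom A B) :
  (k <= n)%N -> (forall i, (i < k)%N -> F i = 0) ->
  \sum_(0 <= i < n) F i = \sum_(k <= i < n) F i.
Proof.
by move=> le_kn F0; rewrite (@big_cat_nat _ _ _ k) //= big_nat big1 ?add0r.
Qed.

(** Faces below [k] pass through [s n k] and vanish on [t]; faces [k] and [k+1] both give [t], with
    opposite signs; the others pass with index lowered by one. For [n = 0] none of these is left,
    whence the match. *)
Lemma d_deg k n (A : C) (t : hom A (Y n.+1)) : (k <= n)%N -> killed k t ->
  cc_d Y n.+1 ∘ s n k ∘ t =
  match n return hom A (Y n.+1) -> hom A (Y n.+1) with
  | 0 => fun _ => 0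
  | m.+1 => fun t => \sum_(k.+1 <= i < m.+2) (s m k ∘ d m.+1 i ∘ t) *~ (-1) ^+ i.+1
  end t.
Proof.
move=> le_kn tk.
rewrite dE !compm_suml (@sum_nat_from k); last 2 first.
- by lia.
- move=> i lt_ik; case: n t le_kn tk => [|n] t le_kn tk; first by lia.
  rewrite !compm_mulzl d_s_lt // -compmA tk ?compm0 ?mul0rz //; lia.
rewrite big_ltn ?[X in _ + X]big_ltn; try lia.
rewrite !compm_mulzl !d_s_eq //; try by [left | right].
rewrite addrA exprS mulN1r mulrNz subrr add0r.
case: n t le_kn tk => [|n] t le_kn tk; first by rewrite big_geq //; lia.
rewrite big_add1 /= !big_nat; apply: eq_bigr => i /andP [lt_ki lt_in].
by rewrite !compm_mulzl d_s_gt.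
Qed.

Lemma deg_d k n (A : C) (t : hom A (Y n.+2)) : (k <= n)%N -> killed k t ->
  s n k ∘ cc_d Y n.+1 ∘ t =
  \sum_(k <= i < n.+2) (s n k ∘ d n.+1 i ∘ t) *~ (-1) ^+ i.
Proof.
move=> le_kn tk; rewrite dE compm_sumr compm_suml (@sum_nat_from k); last 2 first.
- by lia.
- by move=> i lt_ik; rewrite compm_mulzr compm_mulzl -compmA tk ?compm0 ?mul0rz //; lia.
by apply: eq_bigr => i _; rewrite compm_mulzr compm_mulzl.
Qed.

(** In degrees up to [k] the homotopy is zero. In degree [k+1] only [d s_k] contributes, and the sum
    left by [d_deg] is empty. *)
Lemma norm_step_low k n (A : C) (t : hom A (Y n)) :
  (n <= k.+1)%N -> killed k t -> norm_step k n ∘ t = t.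
Proof.
move=> le_nk tk; rewrite /norm_step compmBl comp1m.
suff -> : hboundary (deg_htpy k) n ∘ t = 0 by rewrite subr0.
rewrite /hboundary; case: n t le_nk tk => [|n] t le_nk tk.
  by rewrite /= compm0 addr0 comp0m.
rewrite (@deg_htpy_0 k n) ?comp0m ?addr0 //=.
case: (leqP k n) => [le_kn|_]; last by rewrite compm0 comp0m.
rewrite compm_mulzr compm_mulzl d_deg //.
case: n t {le_nk} tk le_kn (le_nk) => [|n] t tk le_kn le_nk; first by rewrite mul0rz.
by rewrite big_geq ?mul0rz.
Qed.

(** The sums from [d_deg] and [deg_d] cancel except for the term [i = k] of the latter, whose sign
    is [(-1)^k (-1)^k = 1]. *)
Lemma norm_step_high k n (A : C) (t : hom A (Y n.+2)) :
  (k <= n)%N -> killed k t ->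
  norm_step k n.+2 ∘ t = t - s n k ∘ (d n.+1 k ∘ t).
Proof.
move=> le_kn tk; rewrite /norm_step compmBl comp1m; congr (_ - _).
rewrite /hboundary /= le_kn leqW // compm_mulzr !compm_mulzl compmDl !compm_mulzl.
rewrite d_deg ?leqW // deg_d // [X in _ + X *~ _]big_ltn; last by lia.
rewrite -mulrzDl addrCA -big_split /= big1 ?addr0.
  by rewrite -mulrzA -exprD addnn -signr_odd odd_double expr0 compmA.
by move=> i _; rewrite exprS mulN1r mulrNz addNr.
Qed.

(** The new face vanishes by [d_k s_k = 1]. For [i < k], [d_i s_k d_k t = s_{k-1} d_{k-1} d_i t =
    0], so the old ones stay killed. *)
Lemma norm_step_killed k n (A : C) (t : hom A (Y n)) :
  killed k t -> killed k.+1 (norm_step k n ∘ t).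
Proof.
case: n t => [//|[//|n]] t tk; case: (leqP k n) => [le_kn|lt_nk]; last first.
  (* In degree [n+2 <= k+1] the bound [i < n+1] already forces [i < k]. *)
  by rewrite norm_step_low // => i _ lt_in; apply: tk => //; lia.
rewrite norm_step_high // => i; rewrite ltnS leq_eqVlt compmBr compmA.
case/predU1P => [->|lt_ik] lt_in.
  by rewrite d_s_eq ?comp1m ?subrr //; left.
rewrite (tk i) //.
case: n t tk le_kn lt_in => [|n] t tk le_kn lt_in; first by lia.
rewrite d_s_lt // -compmA [d n.+1 i ∘ _]compmA d_d; try lia.
by rewrite -(compmA _ (d n.+2 i)) tk ?compm0 ?subr0 //; lia.
Qed.

Lemma norm_step_fix k n (A : C) (t : hom A (Y n)) :
  killed k.+1 t -> norm_step k n ∘ t = t.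
Proof.
move=> tk; have tk' : killed k t.
  by case: n t tk => [//|n] t tk i lt_ik; apply: tk; lia.
case: (leqP n k.+1) => [le_nk|]; first exact: norm_step_low.
case: n t tk tk' => [//|[//|n]] t tk tk' lt_kn.
by rewrite norm_step_high // tk // compm0 subr0.
Qed.

Fixpoint norm_iter k n : hom (Y n) (Y n) :=
  if k is k'.+1 then norm_step k' n ∘ norm_iter k' n else idm (Y n).

Fixpoint iter_htpy k n : hom (Y n) (Y n.+1) :=
  if k is k'.+1 then iter_htpy k' n + deg_htpy k' n ∘ norm_iter k' n else 0.

Lemma norm_iter_comm k n : cc_d Y n ∘ norm_iter k n.+1 = norm_iter k n ∘ cc_d Y n.
Proof.
elim: k => [|k IH] /=; first by rewrite compm1 comp1m.
by rewrite compmA norm_step_comm -compmA IH compmA.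
Qed.

Lemma norm_iter_killed k n : killed k (norm_iter k n).
Proof.
elim: k => [|k IH] /=; last exact: norm_step_killed.
by case: n => [//|n] i.
Qed.

Lemma norm_iter_stable n : norm_iter n.+1 n = norm_iter n n.
Proof. by rewrite /= norm_step_low //; apply: norm_iter_killed. Qed.

Lemma norm_iter_fix k n (A : C) (t : hom A (Y n)) :
  (forall j, killed j t) -> norm_iter k n ∘ t = t.
Proof.
move=> tk; elim: k => [|k IH] /=; first by rewrite comp1m.
by rewrite -compmA IH norm_step_fix.
Qed.

Lemma iter_htpy_stable n : iter_htpy n.+1 n = iter_htpy n n.
Proof. by rewrite /= deg_htpy_0 // comp0m addr0. Qed.

(** Telescoping: [1 - f g = (1 - g) + (1 - f) g] with [f = norm_step k] and [g = norm_iter k]. As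
    [g] is a chain map, composing the homotopy of [f] with [g] handles the last summand. *)
Lemma iter_htpyE k n : idm (Y n) - norm_iter k n = hboundary (iter_htpy k) n.
Proof.
elim: k => [|k IH] /=.
  by rewrite subrr /hboundary /= compm0 add0r; case: n => //= n; rewrite comp0m.
have -> : hboundary (iter_htpy k.+1) n =
    hboundary (iter_htpy k) n + hboundary (deg_htpy k) n ∘ norm_iter k n.
  rewrite /hboundary /= compmDr compmDl -!addrA; congr (_ + _).
  rewrite compmA addrCA; congr (_ + _); case: n {IH} => [|n].
    by rewrite comp0m addr0.
  by rewrite compmDl -!compmA norm_iter_comm.
by rewrite -IH /norm_step compmBl comp1m opprB addrA addrAC.
Qed.

(** In degree [n] the first [n] factors already give the infinite composite; [norm_iter_stable]
    reconciles the counts [n+1] and [n] in adjacent degrees. *)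
Definition normalization : chain_map Y Y.
Proof.
refine (@ChainMap C Y Y (fun n => norm_iter n n) _) => n.
by rewrite norm_iter_comm norm_iter_stable.
Defined.

Lemma normalization_killed n i :
  (i < n)%N -> d n i ∘ normalization n.+1 = 0.
Proof. by move=> lt_in; apply: (@norm_iter_killed n.+1 n.+1) => //; apply: leqW. Qed.

Lemma normalization_fix n (A : C) (t : hom A (Y n)) :
  (forall j, killed j t) -> normalization n ∘ t = t.
Proof. exact: norm_iter_fix. Qed.

Lemma normalization_homotopic : chain_homotopic normalization (chain_id Y).
Proof.
(* The sign appears because [iter_htpyE] treats the opposite difference, identity minus iterate. *)
exists (fun n => - iter_htpy n n); split=> [|n].
  by rewrite /= subrr oppr0 compm0.
rewrite -opprB [X in - X](iter_htpyE n.+1 n.+1) /hboundary iter_htpy_stable.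
by rewrite opprD compmN compNm.
Qed.

End Normalization.

(** * Faces and pseudoconnections restricted to [N(X)] *)

Section NormFaces.
Variables (C : abelian) (X : pseudocubical C) (G : pseudoconnections X).

(** The range condition sits under the existential so that [norm_face] is total in [i], as the
    abstract section expects. *)
Lemma norm_face_ex n i : exists u : hom (norm_obj X n.+1) (norm_obj X n),
  (i <= n)%N -> norm_incl X n ∘ u = face X n false i.+1 ∘ norm_incl X n.+1.
Proof.
case: (leqP i n) => [le_in|_]; last by exists 0.
suff [u uE] : factors (norm_incl X n) (face X n false i.+1 ∘ norm_incl X n.+1).
  by exists u.
case: n le_in => [|n] le_in; first by exists (face X 0 false i.+1 ∘ norm_incl X 1); rewrite comp1m.
apply: norm_incl_factors => j j_gt0 le_jn; rewrite compmA.
have [lt_ji|le_ij] := ltnP j i.+1.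
  by rewrite face_face // -compmA norm_incl_face ?compm0 //; lia.
by rewrite -(@face_face _ X n false true i.+1 j.+1) // -compmA norm_incl_face ?compm0.
Qed.

Definition norm_face n i : hom (norm_obj X n.+1) (norm_obj X n) :=
  sval (cid (norm_face_ex n i)).

Lemma norm_faceE n i : (i <= n)%N ->
  norm_incl X n ∘ norm_face n i = face X n false i.+1 ∘ norm_incl X n.+1.
Proof. exact: svalP (cid (norm_face_ex n i)). Qed.

(** The two exceptional faces [∂^1] of [Γ_j] equal [s_j ∂_j^1], which vanishes on [N(X)]; every
    other [∂^1] moves past [Γ] and vanishes there too. *)
Lemma norm_conn_ex n j : exists u : hom (norm_obj X n.+1) (norm_obj X n.+2),
  (j <= n)%N -> norm_incl X n.+2 ∘ u = psconn G n j.+1 ∘ norm_incl X n.+1.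
Proof.
case: (leqP j n) => [le_jn|_]; last by exists 0.
suff [u uE] : factors (norm_incl X n.+2) (psconn G n j.+1 ∘ norm_incl X n.+1).
  by exists u.
apply: norm_incl_factors => i i_gt0 le_in; rewrite compmA.
have [ij|nij] : i = j.+1 \/ i = j.+2 \/ ~ (i = j.+1 \/ i = j.+2) by lia.
  by rewrite face1_psconn //; [rewrite -compmA norm_incl_face ?compm0|left].
case: nij => [ij|nij].
  by rewrite face1_psconn //; [rewrite -compmA norm_incl_face ?compm0|right].
case: n le_jn le_in => [|n] le_jn le_in; first by lia.
have [lt_ij|le_ji] := ltnP i j.+1.
  by rewrite face_psconn_lt // -compmA norm_incl_face ?compm0 //; lia.
by rewrite face_psconn_gt // -?compmA ?norm_incl_face ?compm0 //; lia.
Qed.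

Definition norm_conn n j : hom (norm_obj X n.+1) (norm_obj X n.+2) :=
  sval (cid (norm_conn_ex n j)).

Lemma norm_connE n j : (j <= n)%N ->
  norm_incl X n.+2 ∘ norm_conn n j = psconn G n j.+1 ∘ norm_incl X n.+1.
Proof. exact: svalP (cid (norm_conn_ex n j)). Qed.

Lemma norm_d_sum n : norm_d X n = \sum_(0 <= i < n.+1) norm_face n i *~ (-1) ^+ i.
Proof.
apply: (@norm_incl_mono _ X n).
rewrite norm_dE compm_sumr /alt_face compm_suml big_add1 /= !big_nat.
apply: eq_bigr => i /andP [_ lt_in].
by rewrite compm_mulzr compm_mulzl norm_faceE // !exprS !mulN1r opprK.
Qed.

Lemma norm_face_face n i j : (i < j)%N -> (j <= n.+1)%N ->
  norm_face n i ∘ norm_face n.+1 j = norm_face n j.-1 ∘ norm_face n.+1 i.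
Proof.
move=> lt_ij le_jn; apply: (@norm_incl_mono _ X n).
rewrite !compmA !norm_faceE -?compmA ?norm_faceE; try lia.
(* Passing from 1-based to 0-based indices leaves [j] against [j.-1.+1], equal since [j] is
   positive. *)
by rewrite !compmA face_face //=; case: j lt_ij le_jn.
Qed.

Lemma norm_face_conn_lt n i j : (i < j)%N -> (j <= n.+1)%N ->
  norm_face n.+2 i ∘ norm_conn n.+1 j = norm_conn n j.-1 ∘ norm_face n.+1 i.
Proof.
move=> lt_ij le_jn; apply: (@norm_incl_mono _ X n.+2).
rewrite !compmA norm_faceE ?norm_connE -?compmA ?norm_faceE ?norm_connE; try lia.
by rewrite !compmA face_psconn_lt //=; case: j lt_ij le_jn.
Qed.

Lemma norm_face_conn_eq n i j : (j <= n)%N -> i = j \/ i = j.+1 ->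
  norm_face n.+1 i ∘ norm_conn n j = idm (norm_obj X n.+1).
Proof.
move=> le_jn ij; apply: (@norm_incl_mono _ X n.+1).
rewrite !compmA norm_faceE -?compmA ?norm_connE; try lia.
by rewrite compmA face0_psconn ?comp1m ?compm1 //; lia.
Qed.

Lemma norm_face_conn_gt n i j : (j.+1 < i)%N -> (i <= n.+2)%N ->
  norm_face n.+2 i ∘ norm_conn n.+1 j = norm_conn n j ∘ norm_face n.+1 i.-1.
Proof.
move=> lt_ji le_in; apply: (@norm_incl_mono _ X n.+2).
rewrite !compmA norm_faceE ?norm_connE -?compmA ?norm_faceE ?norm_connE; try lia.
by rewrite !compmA face_psconn_gt //=; case: i lt_ji le_in.
Qed.

(** * The retraction of [N(X)] onto [M(X)] *)

Definition norm_retr : chain_map (norm_complex X) (norm_complex X) :=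
  @normalization _ (norm_complex X) norm_face norm_conn norm_d_sum norm_face_face
    norm_face_conn_lt norm_face_conn_eq norm_face_conn_gt.

Lemma moore_retr_ex n : exists u : hom (norm_obj X n) (moore_obj X n),
  moore_to_norm X n ∘ u = norm_retr n.
Proof.
suff [u uE] : factors (moore_incl X n) (norm_incl X n ∘ norm_retr n).
  by exists u; apply: (@norm_incl_mono _ X n); rewrite compmA moore_to_normE.
case: n => [|n]; first by exists (norm_retr 0).
apply: moore_incl_factors => [i i_gt0 le_in|[//|i] _ lt_in].
  by rewrite compmA norm_incl_face ?comp0m.
by rewrite compmA -norm_faceE 1?ltnW // -compmA normalization_killed ?compm0.
Qed.

Definition moore_retr_map n : hom (norm_obj X n) (moore_obj X n) :=
  sval (cid (moore_retr_ex n)).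

Lemma moore_retrE n : moore_to_norm X n ∘ moore_retr_map n = norm_retr n.
Proof. exact: svalP (cid (moore_retr_ex n)). Qed.

Lemma moore_retr_comm n :
  moore_d X n ∘ moore_retr_map n.+1 = moore_retr_map n ∘ norm_d X n.
Proof.
apply: (@moore_to_norm_mono _ X n).
rewrite !compmA moore_retrE -(cm_comm norm_retr).
by rewrite -(cm_comm (moore_to_norm X)) -compmA moore_retrE.
Qed.

Definition moore_retr : chain_map (norm_complex X) (moore_complex X) :=
  @ChainMap C (norm_complex X) (moore_complex X) moore_retr_map moore_retr_comm.

(** Elements of [M(X)] are killed for every [j], so each normalization step fixes them. *)
Lemma moore_retrK n : moore_retr n ∘ moore_to_norm X n = idm (moore_obj X n).
Proof.
apply: (@moore_to_norm_mono _ X n); rewrite compmA moore_retrE compm1.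
apply: normalization_fix => j; case: n => [//|n] i _ lt_in.
apply: (@norm_incl_mono _ X n).
by rewrite compmA norm_faceE 1?ltnW // -compmA moore_to_normE moore_incl_face0 // compm0.
Qed.

Lemma moore_to_norm_equivalence : chain_homotopy_equivalence (moore_to_norm X).
Proof.
exists moore_retr; split.
  (* The retraction is strict on [M(X)], so the zero homotopy suffices. *)
  exists (fun=> 0); split=> [|n]; rewrite [X in X - _]moore_retrK subrr /= ?compm0 //.
  by rewrite comp0m addr0.
have [h [h0 hS]] : chain_homotopic norm_retr (chain_id (norm_complex X)).
  exact: normalization_homotopic.
(* The composite [N -> M -> N] agrees with [norm_retr] degreewise, so the same homotopy serves. *)
by exists h; split=> [|n]; rewrite -?h0 -?hS [X in X - _ = _]moore_retrE.
Qed.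

End NormFaces.

Theorem theorem2p4 (C : abelian) (X : pseudocubical C)
    (G : pseudoconnections X) :
  chain_homotopy_equivalence (moore_to_norm X) /\
  (forall n : nat, isomorphism (homology_map (moore_to_norm X) n)).
Proof.
have eqv := moore_to_norm_equivalence G.
by split=> // n; apply: homotopy_equivalence_homology.
Qed.
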